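(* Let $T$ be an operator semigroup on a set $D$, let $S$ be a $T$-space, let $T^*=\operatorname{End}_T(S)$, and let $$T_{\operatorname{End}(S)}=\{f:D\to D \mid \operatorname{Im}(f|_S)\subseteq S,\ \sigma(f(a))=f(\sigma(a))\ \forall a\in S,\ \sigma\in\operatorname{End}_T(S)\}.$$ (a) $T^*$ is an operator semigroup on $S$, $S$ is a $T^*$-space, and $T_{\operatorname{End}(S)}$ is an operator semigroup on $D$. (b) $\operatorname{End}_{T^*}(S)\supseteq T|_S$, where equality holds if and only if $T|_S=T_{\operatorname{End}(S)}|_S$.
   Context: An operator semigroup on a set $D$ is a (possibly empty) set $T$ of functions $D\to D$ closed under composition. For $U\subseteq D$, $\langle U\rangle_T=\{f(u):f\in T,u\in U\}$; a $T$-space is a subset of $D$ of this form. (If $S$ is a $T$-space then $f(S)\subseteq S$ for all $f\in T$.) A $T$-morphism from a $T$-space $S$ to a $T$-space is a map $\sigma$ with $\sigma(f(a))=f(\sigma(a))$ for all $a\in S$, $f\in T$; $\operatorname{End}_T(S)$ is the set of all $T$-morphisms from $S$ to $S$. For a set $F$ of functions $D\to D$ and $S\subseteq D$, $F|_S=\{f|_S:f\in F\}$, where functions on $S$ with image in $S$ are regarded as functions $S\to S$. *)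

(* Defs.v *)
From mathcomp Require Import all_boot.
From mathcomp Require Import boolp classical_sets.

Set Implicit Arguments.
Unset Strict Implicit.
Unset Printing Implicit Defensive.

Local Open Scope classical_set_scope.

(* A subset S : set D used as a type is the subtype {x : D | x \in S}. *)

Definition operator_semigroup (D : Type) (T : set (D -> D)) : Prop :=
  forall f g, T f -> T g -> T (f \o g).

Definition orbit_space (D : Type) (T : set (D -> D)) (U : set D) : set D :=
  [set f u | f in T & u in U].

Definition is_space (D : Type) (T : set (D -> D)) (S : set D) : Prop :=
  exists U : set D, S = orbit_space T U.

(* s (f a) = f (s a) for all a in S: the point b is f a viewed as an element
   of S.  When f maps S into S (as every f in T does if S is a T-space), such
   a b exists and is unique for each a. *)
Definition commutes (D : Type) (S S' : set D) (f : D -> D) (s : S -> S') :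
    Prop :=
  forall a b : S, val b = f (val a) -> val (s b) = f (val (s a)).

Definition is_morphism (D : Type) (T : set (D -> D)) (S S' : set D)
    (s : S -> S') : Prop :=
  forall f, T f -> commutes f s.

Definition Endo (D : Type) (T : set (D -> D)) (S : set D) : set (S -> S) :=
  [set s | is_morphism T s].
Arguments Endo {D} T S.

(* F|_S as a set of functions S -> S; a member of F that does not map S into
   itself contributes nothing. *)
Definition restr (D : Type) (F : set (D -> D)) (S : set D) : set (S -> S) :=
  [set g | exists2 f, F f & forall a, val (g a) = f (val a)].
Arguments restr {D} F S.

Definition T_Endo (D : Type) (T : set (D -> D)) (S : set D) : set (D -> D) :=
  [set f | f @` S `<=` S /\ forall s : S -> S, Endo T S s -> commutes f s].

(* When the space is all of D, [Endo T setT] consists of functions on the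
   subtype [set: D], which is a copy of D.  This is the same set, transported
   to functions D -> D along the bijection val : [set: D] -> D. *)
Definition Endo_full (D : Type) (T : set (D -> D)) : set (D -> D) :=
  [set g | exists2 s : [set: D] -> [set: D],
     Endo T [set: D] s & forall a, val (s a) = g (val a)].

(* Main.v *)
Require Import Defs.
From mathcomp Require Import all_boot.
From mathcomp Require Import boolp classical_sets.

Local Open Scope classical_set_scope.

(** Everything is about commutation.  If a function [f] on [D] restricts to
    [g] on [S], then a map [s] is compatible with [f] exactly when it commutes
    with [g] ([commutes_restr]).  Hence, for a [T]-space [S], the endomorphism
    set [Endo T S] is the centralizer of the restriction of [T] to [S], and the
    endomorphisms of [S] over [Endo T S] form the bicentralizer
    ([Endo_fullP]).  The semigroup and space claims hold because centralizers
    are closed under composition and contain the identity.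

    The restriction of [T_Endo T S] to [S] is this same bicentralizer
    ([restr_T_Endo]): membership in [T_Endo T S] depends only on the values on
    [S], and every self-map of [S] extends to [D].  So the criterion for equality
    compares the same two sets on both sides, and the inclusion is the fact
    that a set lies in its bicentralizer. *)

Lemma space_stable (D : Type) (T : set (D -> D)) (S : set D) (f : D -> D) :
  operator_semigroup T -> is_space T S -> T f -> f @` S `<=` S.
Proof.
move=> hT [U ->] Tf _ [_ [g Tg [u Uu <-]] <-].
by exists (f \o g); [exact: hT|exists u].
Qed.

Lemma restr_exists (D : Type) (S : set D) (f : D -> D) :
  f @` S `<=` S -> exists g : S -> S, forall a, val (g a) = f (val a).
Proof.
move=> fS; have fSin (a : S) : f (val a) \in S.
  by apply/mem_set/fS; exists (val a) => //; exact/set_mem/valP.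
by exists (fun a => SigSub (fSin a)).
Qed.

Lemma extension_exists (D : Type) (S : set D) (g : S -> S) :
  exists f : D -> D, forall a : S, val (g a) = f (val a).
Proof.
exists (fun x => if insub x is Some a then val (g a) else x) => a.
by rewrite valK.
Qed.

Lemma stable_of_restr (D : Type) (S : set D) (f : D -> D) (g : S -> S) :
  (forall a, val (g a) = f (val a)) -> f @` S `<=` S.
Proof.
move=> gf _ [x Sx <-].
by have := gf (SigSub (mem_set Sx)) => /= <-; exact/set_mem/valP.
Qed.

(** When [f] does restrict to [S], the witness [b] in the definition of
    [commutes] can only be [g a], so the relation becomes an equation between
    composites. *)
Lemma commutes_restr (D : Type) (S : set D) (f : D -> D) (g s : S -> S) :
  (forall a, val (g a) = f (val a)) ->
  commutes f s <-> forall a, s (g a) = g (s a).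
Proof.
move=> gf; split=> [fs a|sg a b].
  by apply: val_inj; rewrite gf; exact/fs/gf.
by rewrite -gf => /val_inj ->; rewrite sg gf.
Qed.

Lemma commutes_id (D : Type) (S : set D) (f : D -> D) :
  commutes f (id : S -> S).
Proof. by []. Qed.

Lemma commutes_comp (D : Type) (S : set D) (f : D -> D) (s t : S -> S) :
  commutes f s -> commutes f t -> commutes f (s \o t).
Proof. by move=> fs ft a b /ft /fs. Qed.

(** Stability of [S] under the inner map [g] is what provides the intermediate
    point [g a] of [S] at which compatibility with [f] is used. *)
Lemma commutes_compl (D : Type) (S : set D) (f g : D -> D) (s : S -> S) :
  g @` S `<=` S -> commutes f s -> commutes g s -> commutes (f \o g) s.
Proof.
move=> /restr_exists[h hg] fs gs a b /=; rewrite -hg => /fs ->.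
by rewrite (gs a (h a)).
Qed.

Lemma Endo_semigroup (D : Type) (T : set (D -> D)) (S : set D) :
  operator_semigroup (Endo T S).
Proof.
by move=> s t Es Et f Tf; apply: commutes_comp; [exact: Es|exact: Et].
Qed.

(** The identity endomorphism makes all of [S] generate [S]. *)
Lemma Endo_space (D : Type) (T : set (D -> D)) (S : set D) :
  is_space (Endo T S) [set: S].
Proof.
exists [set: S]; apply/seteqP; split=> // a _.
by exists id; [move=> f _; exact: commutes_id|exists a].
Qed.

Lemma T_Endo_semigroup (D : Type) (T : set (D -> D)) (S : set D) :
  operator_semigroup (T_Endo T S).
Proof.
move=> f g [fS fE] [gS gE]; split=> [_ [x Sx <-]|s Es].
  by apply: fS; exists (g x) => //; apply: gS; exists x.
by apply: commutes_compl => //; [exact: fE|exact: gE].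
Qed.

(** Over the whole space stability is automatic, so the endomorphisms are
    exactly the centralizer of [T]. *)
Lemma Endo_fullP (D : Type) (T : set (D -> D)) (g : D -> D) :
  Endo_full T g <-> forall f, T f -> forall a, g (f a) = f (g a).
Proof.
split=> [[s Es sg] f Tf a|gT].
  pose in_full (x : D) : [set: D] := SigSub (mem_set (I : [set: D] x)).
  have := Es f Tf (in_full a) (in_full (f a)) erefl.
  by rewrite !sg.
have [s sg] : exists s : [set: D] -> [set: D], forall a, val (s a) = g (val a).
  exact: restr_exists.
exists s => // f Tf a b ba.
by rewrite !sg ba gT.
Qed.

(** Both sides consist of the self-maps of [S] that commute with every
    endomorphism of [S]. *)
Lemma restr_T_Endo (D : Type) (T : set (D -> D)) (S : set D) :
  restr (T_Endo T S) S = Endo_full (Endo T S).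
Proof.
apply/seteqP; split=> g.
  move=> [f [_ fE] gf]; apply/Endo_fullP => s Es a.
  by have /(commutes_restr _ _ _ _ _ gf) -> := fE s Es.
move=> /Endo_fullP gE; have [f gf] := extension_exists _ _ g.
exists f => //; split; first exact: (stable_of_restr _ _ _ _ gf).
by move=> s Es; apply/(commutes_restr _ _ _ _ _ gf) => a; rewrite gE.
Qed.

Lemma sub_T_Endo (D : Type) (T : set (D -> D)) (S : set D) :
  operator_semigroup T -> is_space T S -> T `<=` T_Endo T S.
Proof.
move=> hT hS f Tf; split; first exact: (space_stable _ T).
by move=> s; exact.
Qed.

Theorem theorem18p0p1 (D : Type) (T : set (D -> D)) (S : set D)
    (hT : operator_semigroup T) (hS : is_space T S) :
  let Tstar : set (S -> S) := Endo T S in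
  (operator_semigroup Tstar /\
   is_space Tstar [set: S] /\
   operator_semigroup (T_Endo T S)) /\
  (restr T S `<=` Endo_full Tstar /\
   (Endo_full Tstar = restr T S <->
    restr T S = restr (T_Endo T S) S)).
Proof.
move=> Tstar; split.
  split; first exact: Endo_semigroup.
  by split; [exact: Endo_space|exact: T_Endo_semigroup].
rewrite /Tstar -restr_T_Endo; split; last by split.
by move=> g [f /(sub_T_Endo _ _ _ hT hS) Tf gf]; exists f.
Qed.
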